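(* Let $K$ be a compact Hausdorff space which is extremally disconnected, and let $(V_n)_{n=1}^\infty$ be a sequence of pairwise disjoint open subsets of $K$. Suppose that $(\mu_n)_{n=1}^\infty$ is a sequence of scalar Borel measures on $K$ having uniformly bounded variations. Then, for every $\varepsilon>0$ there exists a strictly increasing sequence $(n_k)_{k=1}^\infty$ of natural numbers such that, for each $k\in\mathbb{N}$, $$|\mu_{n_k}|\Big(\overline{\bigcup_{j\neq k}V_{n_j}}\Big)<\varepsilon.$$
   Context: A space is extremally disconnected if the closure of every open set is open. Scalar measures are countably additive real- or complex-valued measures on the Borel $\sigma$-algebra of $K$; $|\mu|$ denotes the variation of $\mu$, and uniformly bounded variations means $\sup_n|\mu_n|(K)<\infty$. The bar denotes closure in $K$. *)

(* Defs.v *)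
From HB Require Import structures.
From mathcomp Require Import all_boot all_order all_algebra.
From mathcomp Require Import complex.
From mathcomp Require Import all_classical all_reals all_analysis.

Set Implicit Arguments.
Unset Strict Implicit.
Unset Printing Implicit Defensive.

Import Order.TTheory GRing.Theory Num.Theory.
Import numFieldNormedType.Exports.

Local Open Scope classical_set_scope.
Local Open Scope ring_scope.

Definition extremally_disconnected (K : topologicalType) : Prop :=
  forall U : set K, open U -> open (closure U).

(* [measurableType] is not used because it would force [K] to be pointed,
   hence nonempty. *)
Definition borel (K : topologicalType) : set (set K) := <<s @open K >>.

(* The scalar field [F] is [R] or [R[i]], and [modulus] is its absolute value.
   On [R[i]] the norm [`|z|] is a real element of [R[i]]; [Re] reads it in [R]. *)
Inductive scalar_field (R : realType) :
    forall F : numFieldType, (F -> R) -> Prop :=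
| real_scalars : scalar_field (fun x : R => `|x|)
| complex_scalars : scalar_field (fun z : R[i] => complex.Re `|z|).

(* Values outside the Borel sets are irrelevant.  Taking every [E i] empty
   forces [mu set0 = 0]. *)
Definition scalar_borel_measure (K : topologicalType) (F : numFieldType)
    (mu : set K -> F) : Prop :=
  forall E : nat -> set K, (forall i, borel (E i)) -> trivIset setT E ->
    series (fun i => mu (E i)) @ \oo --> mu (\bigcup_i E i).

(* Supremum over the finite Borel partitions of [A]; meant for [A] Borel. *)
Definition measure_variation (R : realType) (K : topologicalType) (F : numFieldType)
    (modulus : F -> R) (mu : set K -> F) (A : set K) : \bar R :=
  ereal_sup [set x | exists (n : nat) (E : nat -> set K),
    [/\ forall i, (i < n)%N -> borel (E i),
        trivIset `I_n E,
        \bigcup_(i in `I_n) E i = A &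
        x = (\sum_(i < n) modulus (mu (E i)))%:E]].

(* Main.v *)
Require Import Defs.
From HB Require Import structures.
From mathcomp Require Import all_boot all_order all_algebra.
From mathcomp Require Import complex.
From mathcomp Require Import all_classical all_reals all_analysis.

Set Implicit Arguments.
Unset Strict Implicit.

Import Order.TTheory GRing.Theory Num.Theory.
Import numFieldNormedType.Exports.

Local Open Scope classical_set_scope.
Local Open Scope ring_scope.

(** Put [W A] for the closure of the union of the [V j] with [j] in [A].  In an
    extremally disconnected space disjoint open sets have disjoint closures, so
    [A |-> W A] sends disjoint sets of indices to disjoint sets, and it sends
    unions to unions.  Since variations are superadditive on disjoint Borel sets,
    [nu n A], the variation of [mu n] on [W A], is for each [n] a nonnegative
    superadditive function of the set [A] of indices, bounded by the common
    bound [M] of the variations.  If [nk] is strictly increasing with values in [T], the closure in the conclusion lies in [W (T `\ nk k)], so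
    everything reduces to a purely combinatorial form of Rosenthal's lemma
    ([rosenthal]): there is an infinite set [T] of indices with
    [nu k (T `\ k) < e] for every [k] in [T].

    Rosenthal's lemma is proved by exhaustion.  Choose infinitely many disjoint
    infinite subsets [N p] of an infinite set [S] of indices.  If no [N p]
    can serve as [T], then each contains some [f p] with
    [e <= nu (f p) (N p `\ f p)].  The range of [f] is disjoint from every
    [N p `\ f p], so by superadditivity each of the functions [nu (f p)] is
    smaller by at least [e] on the range of [f] than on [S].  Passing from [S] to the
    range of [f] thus lowers the bound by [e], which can happen only about
    [M / e] times. *)

Lemma infinite_nat_enum (A : set nat) : infinite_set A ->
  exists s : nat -> nat, {homo s : i j / (i < j)%N} /\ forall n, A (s n).
Proof.
move=> Aoo.
have /= [|s [sincr _ As]] := @infinite_increasing_seq_wf _ nat A _ Aoo 0%N.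
  by move=> n; apply: sub_finite_set (finite_II n.+1) => m /=.
exists s; split=> // i j ij.
by have := leW_mono sincr i j; rewrite !ltEnat /= ij.
Qed.

Lemma infinite_range (s : nat -> nat) : injective s -> infinite_set (range s).
Proof.
move=> s_inj; rewrite (eq_finite_set (B := [set: nat])).
  exact: infinite_nat.
by apply: inj_card_eq => i j _ _; exact: s_inj.
Qed.

(** An injection of [nat * nat] into [S], here obtained by coding pairs of
    naturals, has disjoint infinite rows. *)
Lemma infinite_disjoint_family (S : set nat) : infinite_set S ->
  exists N : nat -> set nat,
    [/\ forall p, infinite_set (N p), forall p, N p `<=` S & trivIset setT N].
Proof.
move=> /infinite_nat_enum[s [s_incr Ss]].
have s_inj : injective s.
  move=> i j sij; apply/eqP; case: ltngtP => // /s_incr; by rewrite sij ltnn.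
pose t (p q : nat) := s (pickle (p, q)).
have t_inj p p' q q' : t p q = t p' q' -> p = p' /\ q = q'.
  by move=> /s_inj/(pcan_inj pickleK)[-> ->].
exists (fun p => range (t p)); split.
- by move=> p; apply: infinite_range => q q' /t_inj[].
- by move=> p _ [q _ <-]; exact: Ss.
- by move=> p p' _ _ [_ [[q _ <-] [q' _ /t_inj[-> _]]]].
Qed.

Lemma superadditive_mono (T : Type) (R : realDomainType) (nu : set T -> R)
    (nu_ge0 : forall A, 0 <= nu A)
    (nu_super : forall A B, A `&` B = set0 -> nu A + nu B <= nu (A `|` B))
    (A B : set T) : A `<=` B -> nu A <= nu B.
Proof.
move=> AB; rewrite -(setDUK AB); apply: le_trans (nu_super _ _ _).
  by rewrite lerDl.
exact: setDIK.
Qed.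

(** The induction is on the number [m] of steps [e] that the bound on [S] still
    allows: for [m = 0] the bound contradicts nonnegativity, and each failure to
    find [T] inside [S] produces a subset on which [m] is smaller by one. *)
Lemma rosenthal (R : realDomainType) (nu : nat -> set nat -> R)
    (nu_ge0 : forall k A, 0 <= nu k A)
    (nu_super : forall k A B, A `&` B = set0 -> nu k A + nu k B <= nu k (A `|` B))
    (e : R) (m : nat) (S : set nat) :
    infinite_set S -> (forall k, S k -> nu k S < e *+ m) ->
  exists T : set nat,
    [/\ infinite_set T, T `<=` S & forall k, T k -> nu k (T `\ k) < e].
Proof.
have nu_mono k A B : A `<=` B -> nu k A <= nu k B.
  exact: (superadditive_mono (nu_ge0 k) (nu_super k)).
elim: m S => [|m IHm] S Soo nuS.
  have [k Sk] := infinite_setN0 Soo.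
  by have := le_lt_trans (nu_ge0 k S) (nuS k Sk); rewrite mulr0n ltxx.
have [N [Noo NS Ntriv]] := infinite_disjoint_family Soo.
apply: contrapT => noT.
have /choice[f fP] p : exists k, N p k /\ ~ (nu k (N p `\ k) < e).
  apply: contrapT => nok; apply: noT; exists (N p); split => // k Nk.
  by apply: contrapT => nuk; apply: nok; exists k.
have f_inj : injective f.
  move=> p q fpq; apply: Ntriv => //; exists (f p).
  by split; [exact: (fP p).1|rewrite fpq; exact: (fP q).1].
have fS : range f `<=` S by move=> _ [p _ <-]; apply: (NS p); exact: (fP p).1.
(* A value [f q] in [N p] forces [q = p], as [f q] also lies in [N q]. *)
have disj p : range f `&` (N p `\ f p) = set0.
  rewrite -subset0 => _ [[q _ <-] [Nq]]; apply; congr f.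
  by apply: Ntriv => //; exists (f q); split; [exact: (fP q).1|].
have [_ [p _ <-]|T [Too TS nuT]] := IHm _ (infinite_range f_inj).
  have : nu (f p) (range f) + nu (f p) (N p `\ f p) < e *+ m.+1.
    apply: le_lt_trans (nuS _ (NS p _ (fP p).1)).
    apply: le_trans (nu_super _ _ _ (disj p)) _; apply: nu_mono.
    by rewrite subUset; split=> // x [Nx _]; exact: (NS p).
  apply: contraPlt => le_m; apply/negP; rewrite -leNgt mulrSr.
  by apply: lerD => //; rewrite leNgt; apply/negP; exact: (fP p).2.
by apply: noT; exists T; split=> //; exact: subset_trans fS.
Qed.

Section variation.
Context {R : realType} {K : topologicalType} {F : numFieldType}.
Context (modulus : F -> R) (mu : set K -> F).
Context (modulus_ge0 : forall z, 0 <= modulus z).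

(** The variation on [A] is by definition the supremum of this set; naming the set
    separates the manipulation of partitions from that of suprema. *)
Let partition_sums (A : set K) : set (\bar R) :=
  [set x | exists (n : nat) (E : nat -> set K),
    [/\ forall i, (i < n)%N -> borel (E i),
        trivIset `I_n E,
        \bigcup_(i in `I_n) E i = A &
        x = (\sum_(i < n) modulus (mu (E i)))%:E]].

Local Notation variation := (measure_variation modulus mu).

Let partition_sums1 A : borel A -> partition_sums A (modulus (mu A))%:E.
Proof.
move=> bA; exists 1%N, (fun=> A); split=> //.
- by move=> [|i] [|j].
- by rewrite bigcup_const//; exists 0%N.
- by rewrite big_ord1.
Qed.

Lemma measure_variation_ge0 A : borel A -> (0 <= variation A)%E.
Proof.
move=> bA; apply: (@le_trans _ _ (modulus (mu A))%:E); first by rewrite lee_fin.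
by apply: ereal_sup_ubound; exact: partition_sums1.
Qed.

Let partition_sums_cat A B x y : A `&` B = set0 ->
  partition_sums A x -> partition_sums B y -> partition_sums (A `|` B) (x + y)%E.
Proof.
move=> AB0 [n [E [bE tE EA ->]]] [m [G [bG tG GB ->]]].
have disj i j : (i < n)%N -> (j < m)%N -> ~ (E i `&` G j !=set0).
  move=> lin ljm [z [Ez Gz]]; suff: set0 z by [].
  by rewrite -AB0 -EA -GB; split; [exists i|exists j].
exists (n + m)%N, (fun i => if (i < n)%N then E i else G (i - n)%N); split.
- by move=> i inm; case: ltnP => [/bE//|ni]; apply: bG; rewrite ltn_subLR.
- move=> i j /= inm jnm; case: ltnP => ni; case: ltnP => nj.
  + exact: tE.
  + by move=> /disj; rewrite ltn_subLR// => /(_ ni jnm).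
  + by rewrite setIC => /disj; rewrite ltn_subLR// => /(_ nj inm).
  + move=> /tG/=; rewrite !ltn_subLR// => /(_ inm jnm) ij.
    by rewrite -(subnKC ni) ij subnKC.
- rewrite -EA -GB; apply/seteqP.
  split => [z [i /= inm]|z [[i /= lin Ez]|[j /= jm Gz]]].
  + case: ltnP => ni Ez; [left; by exists i|right; exists (i - n)%N => //=].
    by rewrite ltn_subLR.
  + by exists i; rewrite /= ?lin//; exact: ltn_addr.
  + by exists (n + j)%N; rewrite /= ?ltn_add2l// ltnNge leq_addr/= addKn.
- rewrite -EFinD big_split_ord /=; congr (_ + _)%:E; apply: eq_bigr => i _.
  + by rewrite ltn_ord.
  + by rewrite ltnNge leq_addr/= addKn.
Qed.

(** Concatenating partitions of [A] and of [B] gives only some of the partitions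
    of their union, so the two suprema add up to at most the one on the union. *)
Lemma measure_variation_superadditive A B : borel A -> borel B ->
    A `&` B = set0 ->
  (variation A + variation B <= variation (A `|` B))%E.
Proof.
move=> bA bB AB0.
have [->|varAB] := eqVneq (variation (A `|` B)) +oo%E; first by rewrite leey.
have sum_fin C x : partition_sums C x -> x \is a fin_num.
  by move=> [? [? [_ _ _ ->]]].
have varA_add y : partition_sums B y -> (variation A + y <= variation (A `|` B))%E.
  move=> By; rewrite -leeBrDr ?(sum_fin _ _ By)//; apply: ge_ereal_sup => x Ax.
  rewrite leeBrDr ?(sum_fin _ _ By)//.
  by apply: ereal_sup_ubound; exact: partition_sums_cat.
(* Adding the finite sum of the one-piece partition of [B] shows that an infinite
   variation on [A] makes the variation on the union infinite. *)
have varA_fin : variation A \is a fin_num.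
  rewrite ge0_fin_numE ?measure_variation_ge0// ltey.
  apply: contra varAB => /eqP A_oo; rewrite -leye_eq.
  have := varA_add (modulus (mu B))%:E; rewrite A_oo; apply.
  exact: partition_sums1.
rewrite -leeBrDl//; apply: ge_ereal_sup => y By.
by rewrite leeBrDl//; exact: varA_add.
Qed.

End variation.

Lemma modulus_ge0 (R : realType) (F : numFieldType) (modulus : F -> R) :
  scalar_field modulus -> forall z, 0 <= modulus z.
Proof.
case=> [x|z]; first exact: normr_ge0.
by have := normr_ge0 z; rewrite lecE => /andP[].
Qed.

(** A common point of the closures has [closure U] as a neighbourhood, because
    [closure U] is open; hence [V] meets [closure U], and [V], being open, then
    meets [U] itself. *)
Lemma extremally_disconnected_closureI (K : topologicalType) (U V : set K) :
    extremally_disconnected K -> open U -> open V ->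
  U `&` V = set0 -> closure U `&` closure V = set0.
Proof.
move=> edK oU oV UV0; rewrite -subset0 => x [Ux Vx].
have [y [Vy Uy]] := Vx _ (open_nbhs_nbhs (conj (edK U oU) Ux)).
by have [z] := Uy _ (open_nbhs_nbhs (conj oV Vy)); rewrite UV0.
Qed.

Lemma borel_closure (K : topologicalType) (A : set K) : borel (closure A).
Proof.
rewrite -[closure A]setCK -setTD; apply: sigma_algebraCD.
apply: sub_sigma_algebra; apply: closed_openC; exact: closed_closure.
Qed.

Theorem lemma2p2 (R : realType) (F : numFieldType) (modulus : F -> R)
    (hF : scalar_field modulus)
    (K : topologicalType)
    (cptK : compact [set: K]) (hausK : hausdorff_space K)
    (edK : extremally_disconnected K)
    (V : nat -> set K) (openV : forall n, open (V n)) (disjV : trivIset setT V)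
    (mu : nat -> set K -> F) (mu_meas : forall n, scalar_borel_measure (mu n))
    (mu_bdd : (ereal_sup [set measure_variation modulus (mu n) [set: K] | n in [set: nat]]
               < +oo)%E)
    (e : R) (e0 : 0 < e) :
  exists nk : nat -> nat, {homo nk : i j / (i < j)%N} /\
    forall k : nat,
      (measure_variation modulus (mu (nk k))
         (closure (\bigcup_(j in [set j | j != k]) V (nk j))) < e%:E)%E.
Proof.
have m0 := modulus_ge0 hF.
pose W (A : set nat) := closure (\bigcup_(j in A) V j).
pose var n := measure_variation modulus (mu n).
have bW A : borel (W A) by exact: borel_closure.
have WU A B : W (A `|` B) = W A `|` W B by rewrite /W bigcup_setU closureU.
have WI A B : A `&` B = set0 -> W A `&` W B = set0.
  move=> AB0; apply: extremally_disconnected_closureI => //.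
  1,2: exact: bigcup_open.
  rewrite -subset0 => x [[i Ai Vi] [j Bj Vj]].
  have ij : i = j by apply: disjV => //; exists x.
  suff : (A `&` B) i by rewrite AB0.
  by split; [exact: Ai|rewrite ij].
have var_ge0 n A : (0 <= var n (W A))%E by exact: measure_variation_ge0.
have var_super n A B : borel A -> borel B -> A `&` B = set0 ->
  (var n A + var n B <= var n (A `|` B))%E.
  exact: measure_variation_superadditive.
set M := ereal_sup _ in mu_bdd.
have var_bdd n A : (var n (W A) <= M)%E.
  have bWC : borel (~` W A) by rewrite -setTD; apply: sigma_algebraCD; exact: bW.
  apply: (@le_trans _ _ (var n [set: K])); last by apply: ereal_sup_ubound; exists n.
  rewrite -(setUv (W A)); apply: le_trans (var_super _ _ _ _ _ _) => //.
    by apply: leeDl; exact: measure_variation_ge0.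
  exact: setICr.
have var_fin n A : var n (W A) \is a fin_num.
  by rewrite ge0_fin_numE//; exact: le_lt_trans (var_bdd n A) _.
pose nu n A := fine (var n (W A)).
have nuE n A : (nu n A)%:E = var n (W A) by rewrite fineK.
have M_fin : M \is a fin_num.
  by rewrite ge0_fin_numE//; exact: le_trans (var_bdd 0%N set0).
have nu_ge0 n A : 0 <= nu n A by rewrite -lee_fin nuE.
have nu_super n A B : A `&` B = set0 -> nu n A + nu n B <= nu n (A `|` B).
  move=> AB0; rewrite -lee_fin EFinD !nuE WU.
  by apply: var_super => //; exact: WI.
(* Any number of steps [m] with [M < e *+ m] will do. *)
have [||T [Too _ nuT]] :=
  @rosenthal R nu nu_ge0 nu_super e (Num.truncn (fine M / e)).+1 setT.
- exact: infinite_nat.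
- move=> n _; apply: (@le_lt_trans _ _ (fine M)).
    by rewrite -lee_fin nuE fineK.
  by rewrite -mulr_natl -ltr_pdivrMr// truncnS_gt.
have [nk [nk_incr Tnk]] := infinite_nat_enum Too.
exists nk; split=> // k.
have nk_image : W (nk @` [set j | j != k])
    = closure (\bigcup_(j in [set j | j != k]) V (nk j)).
  by rewrite /W bigcup_image.
rewrite -nk_image -/(var _ _) -nuE lte_fin.
apply: le_lt_trans (nuT _ (Tnk k)); apply: (superadditive_mono (nu_ge0 _) (nu_super _)).
move=> _ [j /= jk <-]; split=> // /eqP; apply/negP.
by case: ltngtP jk => // /nk_incr; [rewrite neq_ltn => ->|rewrite neq_ltn orbC => ->].
Qed.
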